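(* For every $\epsilon>0$ there exist $\mu_\epsilon\in(0,1)$ and $C_\epsilon>0$, depending only on $\epsilon$, such that the following holds. Let $n\in\mathbb{N}$ and let $V$ and $W$ be any convex symmetric bodies in $\mathbb{R}^n$ with $V\subset B_{(2)}^n$. Then in any linear subspace $L_m\subset\mathbb{R}^n$ with $m=\dim L_m\ge\mu_\epsilon n$ there is a nonzero $\alpha^{\ast}\in L_m$ such that $$\frac{\|\alpha^{\ast}\|_V}{\|\alpha^{\ast}\|_W}\le C_\epsilon\,(M_V)^{1+\epsilon}\,M_{W^o}.$$
   Context: $\langle\alpha,\beta\rangle=\sum_{k=1}^n\alpha_k\beta_k$ and $\|\alpha\|_{(2)}=\langle\alpha,\alpha\rangle^{1/2}$ on $\mathbb{R}^n$; $B_{(2)}^n=\{\alpha\in\mathbb{R}^n:\|\alpha\|_{(2)}\le1\}$ and $\mathbb{S}^{n-1}=\{\alpha\in\mathbb{R}^n:\|\alpha\|_{(2)}=1\}$. For a convex centrally symmetric body $V\subset\mathbb{R}^n$, $\|\cdot\|_V$ denotes the norm on $\mathbb{R}^n$ with closed unit ball $V$, and the polar body is $V^o=\{\alpha\in\mathbb{R}^n:\sup_{\beta\in V}|\langle\alpha,\beta\rangle|\le1\}$, so $\|\alpha\|_{V^o}=\sup_{\beta\in V}|\langle\alpha,\beta\rangle|$. The Lévy mean is $M_V=\int_{\mathbb{S}^{n-1}}\|\alpha\|_V\,d\mu(\alpha)$, where $\mu$ is the normalized rotation-invariant measure on $\mathbb{S}^{n-1}$. *)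

(* Defs.v *)
From mathcomp Require Export all_boot all_order all_algebra.
From mathcomp Require Export all_classical all_reals all_analysis.
Set Implicit Arguments.
Unset Strict Implicit.
Unset Printing Implicit Defensive.
Import Order.TTheory GRing.Theory Num.Theory.
Export numFieldNormedType.Exports.

Local Open Scope classical_set_scope.
Local Open Scope ring_scope.

(* R^n is 'rV[R]_n. Its library norm is the sup norm, which induces the usual
   topology; the Euclidean structure is therefore defined here. *)
Definition dotv (R : realType) (n : nat) (a b : 'rV[R]_n) : R :=
  \sum_(k < n) a ord0 k * b ord0 k.

Definition norm2 (R : realType) (n : nat) (a : 'rV[R]_n) : R :=
  Num.sqrt (dotv a a).

Definition unit_ball2 (R : realType) (n : nat) : set 'rV[R]_n :=
  [set a | norm2 a <= 1].

Definition unit_sphere2 (R : realType) (n : nat) : set 'rV[R]_n :=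
  [set a | norm2 a = 1].

Definition symmetric_convex_body (R : realType) (n : nat) (V : set 'rV[R]_n) :=
  [/\ compact V, V° !=set0,
      convex_set (V : set (convex_lmodType 'rV[R]_n)) &
      forall a, V a -> V (- a)].

(* The norm with closed unit ball V, as the Minkowski functional
   inf {t > 0 | a \in t V}. *)
Definition body_norm (R : realType) (n : nat) (V : set 'rV[R]_n)
    (a : 'rV[R]_n) : R :=
  inf [set t | 0 < t /\ exists2 b, V b & a = t *: b].

(* The supremum is taken in \bar R because [sup] returns 0 on unbounded sets. *)
Definition polar (R : realType) (n : nat) (V : set 'rV[R]_n) : set 'rV[R]_n :=
  [set a | (ereal_sup [set (`|dotv a b|)%:E | b in V] <= 1)%E].

Definition borel_rV (R : realType) (n : nat) :=
  g_sigma_algebraType (@open 'rV[R]_n).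

(* The normalized rotation-invariant measure on the sphere, as a Borel
   probability on R^n carried by the sphere. For n > 0 exactly one measure has
   these properties; rotations range over all of O(n), since SO(1) is trivial
   and would not determine the measure when n = 1. *)
Definition uniform_on_sphere (R : realType) (n : nat)
    (mu : probability (borel_rV R n) R) :=
  mu (@unit_sphere2 R n) = 1%E /\
  forall (Q : 'M[R]_n) (A : set (borel_rV R n)),
    Q *m Q^T = 1%:M -> measurable A ->
    mu [set x : 'rV[R]_n | A (x *m Q)] = mu A.

Definition levy_mean (R : realType) (n : nat)
    (mu : probability (borel_rV R n) R) (V : set 'rV[R]_n) : R :=
  \int[mu]_(a in @unit_sphere2 R n) body_norm V a.

(* Main.v *)
Require Import Defs.
From mathcomp Require Import perm ring lra.
Set Implicit Arguments.
Unset Strict Implicit.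
Unset Printing Implicit Defensive.
Import Order.TTheory GRing.Theory Num.Theory.
Local Open Scope classical_set_scope.
Local Open Scope ring_scope.

(* Let P be the orthogonal projection onto L and Q = 2P - 1 the orthogonal
   reflection in L. Since x P = (x + x Q) / 2, rotation invariance shows that
   the mean of |x P|_K over the sphere is at most M_K for every norm. On the
   other hand the mean of |x P|_(2)^2 is tr P / n = m / n. If m >= n / 2, some x
   therefore satisfies |x P|_V / M_V + |x P|_{W^o} / M_{W^o} <= 8 |x P|_(2)^2
   with x P != 0. Then a = x P works, because |a|_(2)^2 <= |a|_W |a|_{W^o}
   and |a|_(2) <= 1. This gives the bound 64 M_V M_{W^o}; as V lies in the
   Euclidean ball, M_V >= 1 and thus M_V <= M_V^(1+eps). *)

Lemma normr_mxE_le {R : realType} {m n} (A : 'M[R]_(m, n)) i j :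
  `|A i j| <= `|A|.
Proof. by rewrite [leRHS]/Num.Def.normr/= mx_normrE (le_bigmax _ _ (i, j)). Qed.

(** * Gauges of absorbing disks: seminorm inequalities and continuity *)

Section gauge.
Context {R : realType} {n : nat}.
Implicit Types (K V : set 'rV[R]_n) (x y : 'rV[R]_n) (t r : R).

(* Closedness is not demanded: the gauge is a continuous seminorm without it. *)
Definition absorbing_disk K :=
  [/\ forall x y t, 0 <= t <= 1 -> K x -> K y -> K (t *: x + (1 - t) *: y),
      forall x, K x -> K (- x) &
      exists2 r, 0 < r & forall x, `|x| <= r -> K x].

Lemma body_norm_set_lb K x :
  has_lbound [set t | 0 < t /\ exists2 b, K b & x = t *: b].
Proof. by exists 0 => t [/ltW]. Qed.

Lemma body_norm_le K t b : 0 < t -> K b -> body_norm K (t *: b) <= t.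
Proof.
move=> t0 Kb; apply: ge_inf; first exact: body_norm_set_lb.
by split => //; exists b.
Qed.

Lemma body_norm_le_ball K r x t : (forall y, `|y| <= r -> K y) ->
  0 < t -> `|x| <= t * r -> body_norm K x <= t.
Proof.
move=> Kr t0 xt.
rewrite -[x](scalerKV (lt0r_neq0 t0)); apply: body_norm_le => //; apply: Kr.
by rewrite normrZ gtr0_norm ?invr_gt0// ler_pdivrMl.
Qed.

(** Since [inf] takes a default value on sets without an infimum, the set of scales must be shown
    nonempty; the ball inside [K] provides a scale. *)
Lemma body_norm_adherent K x e : absorbing_disk K -> 0 < e ->
  exists t b, [/\ 0 < t, K b, x = t *: b & t < body_norm K x + e].
Proof.
move=> [_ _ [r r0 Kr]] e0.
suff hinf : has_inf [set t | 0 < t /\ exists2 b, K b & x = t *: b].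
  have [t [t0 [b Kb xE]] te] := inf_adherent e0 hinf.
  by exists t, b; split.
split; last exact: body_norm_set_lb.
have t0 : 0 < (`|x| + 1) / r by rewrite divr_gt0// ltr_wpDl.
exists ((`|x| + 1) / r); split => //; exists (((`|x| + 1) / r)^-1 *: x).
  apply: Kr; rewrite normrZ gtr0_norm ?invr_gt0// ler_pdivrMl//.
  by rewrite mulrAC mulfK ?gt_eqF// lerDl.
by rewrite scalerKV// gt_eqF.
Qed.

Lemma body_norm_ge K x c : absorbing_disk K ->
  (forall t b, 0 < t -> K b -> x = t *: b -> c <= t) -> c <= body_norm K x.
Proof.
move=> dK h; apply/ler_addgt0Pr => e e0.
have [t [b [t0 Kb xE /ltW]]] := body_norm_adherent x dK e0.
exact/le_trans/(h t b).
Qed.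

Lemma body_norm_ge0 K x : absorbing_disk K -> 0 <= body_norm K x.
Proof. by move=> dK; apply: body_norm_ge => // t b /ltW. Qed.

(** Take nearly optimal scales [x = s *: b] and [y = t *: c]. Then [x + y] is [s + t] times the
    convex combination of [b] and [c] with weights [s / (s + t)] and [t / (s + t)]. *)
Lemma body_normD K x y : absorbing_disk K ->
  body_norm K (x + y) <= body_norm K x + body_norm K y.
Proof.
move=> dK; apply/ler_addgt0Pr => e e0; have e2 : 0 < e / 2 by rewrite divr_gt0.
have [s [b [s0 Kb xE ps]]] := body_norm_adherent x dK e2.
have [t [c [t0 Kc yE pt]]] := body_norm_adherent y dK e2.
apply: (@le_trans _ _ (s + t)); last lra.
have st0 : 0 < s + t by rewrite addr_gt0.
have -> : x + y = (s + t) *: ((s / (s + t)) *: b + (1 - s / (s + t)) *: c).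
  rewrite xE yE scalerDr !scalerA mulrBr mulr1 !(mulrC (s + t)).
  rewrite !divfK ?gt_eqF//.
  by congr (_ + _ *: _); lra.
apply: body_norm_le => //; have [cK _ _] := dK; apply: cK => //.
apply/andP; split; first by rewrite divr_ge0// ltW.
by rewrite ler_pdivrMr// mul1r lerDl ltW.
Qed.

Lemma body_normZ K x c : absorbing_disk K -> 0 < c ->
  body_norm K (c *: x) <= c * body_norm K x.
Proof.
move=> dK c0; rewrite -ler_pdivrMl//; apply: body_norm_ge => // t b t0 Kb ->.
by rewrite ler_pdivrMl// scalerA; apply: body_norm_le => //; rewrite mulr_gt0.
Qed.

Lemma body_norm_midpoint K x y : absorbing_disk K ->
  body_norm K (2^-1 *: (x + y)) <= (body_norm K x + body_norm K y) / 2.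
Proof.
move=> dK; rewrite mulrC; apply: le_trans (body_normZ _ dK _) _.
  by rewrite invr_gt0.
by rewrite ler_pM2l ?invr_gt0//; exact: body_normD.
Qed.

(** By subadditivity the gauge is Lipschitz for the sup norm with constant [1 / r], where [r] is the
    radius of a ball inside [K]. *)
Lemma body_norm_continuous K : absorbing_disk K -> continuous (body_norm K).
Proof.
move=> dK; have [_ _ [r r0 Kr]] := dK.
have lip x y : body_norm K x - body_norm K y <= `|x - y| / r.
  apply: (@le_trans _ _ (body_norm K (x - y))).
    by rewrite lerBlDr -{1}(subrK y x); exact: body_normD.
  apply/ler_addgt0Pr => e e0; apply: body_norm_le_ball Kr _ _.
    by rewrite ltr_wpDl// divr_ge0// ltW.
  by rewrite mulrDl divfK ?gt_eqF// lerDl mulr_ge0// ltW.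
move=> x; apply/(@cvgrPdist_le _ _ _ _ (nbhs_filter x)) => e e0; near=> y.
apply: (@le_trans _ _ (`|x - y| / r)).
  rewrite ler_norml lip lerNl opprB andbT.
  by rewrite -(normrN (x - y)) opprB lip.
rewrite ler_pdivrMr//; near: y.
have /cvgrPdist_le : id @ x --> x by exact: cvg_id.
by apply; rewrite mulr_gt0.
Unshelve. all: by end_near. Qed.

(** A ball around an interior point [a] is carried to the origin: [x] is the midpoint of [a + x] and
    [- (a - x)], and the latter lies in [V] by symmetry. *)
Lemma absorbing_disk_body V : symmetric_convex_body V -> absorbing_disk V.
Proof.
move=> [_ [a aV] cV sV].
have cV' x y t : 0 <= t <= 1 -> V x -> V y -> V (t *: x + (1 - t) *: y).
  move=> /andP[t0 t1] Vx Vy.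
  exact: set_mem (cV x y (Itv01 t0 t1) (mem_set Vx) (mem_set Vy)).
split => //.
have /nbhs_ballP[r /= r0 arV] := aV.
(* Neighbourhood balls are open, whereas a closed ball is wanted; hence half the radius. *)
exists (r / 2); first by rewrite divr_gt0.
move=> x xr.
have h y : `|y| <= r / 2 -> V (a + y).
  move=> yr; apply: arV; rewrite -ball_normE /= opprD addNKr normrN.
  by apply: le_lt_trans yr _; rewrite ltr_pdivrMr// ltr_pMr// ltr1n.
have -> : x = 2^-1 *: (a + x) + (1 - 2^-1) *: (- (a - x)).
  apply/rowP => i; rewrite !mxE; lra.
apply: cV'; first lra.
- exact: h.
- by apply: sV; apply: h; rewrite normrN.
Qed.

End gauge.

(** * Euclidean inner product and polarity *)

Section dot.
Context {R : realType} {n : nat}.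
Implicit Types (K V W : set 'rV[R]_n) (a b : 'rV[R]_n) (t : R).

Lemma dotvE a b : dotv a b = (a *m b^T) ord0 ord0.
Proof. by rewrite mxE; apply: eq_bigr => i _; rewrite mxE. Qed.

Lemma dotvDl a b c : dotv (a + b) c = dotv a c + dotv b c.
Proof. by rewrite !dotvE mulmxDl mxE. Qed.

Lemma dotvZl t a b : dotv (t *: a) b = t * dotv a b.
Proof. by rewrite !dotvE -scalemxAl mxE. Qed.

Lemma dotvC a b : dotv a b = dotv b a.
Proof. by apply: eq_bigr => i _; rewrite mulrC. Qed.

Lemma dotvZr t a b : dotv a (t *: b) = t * dotv a b.
Proof. by rewrite dotvC dotvZl dotvC. Qed.

Lemma dotvNl a b : dotv (- a) b = - dotv a b.
Proof. by rewrite -scaleN1r dotvZl mulN1r. Qed.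

Lemma dotv_ge0 a : 0 <= dotv a a.
Proof. by apply: sumr_ge0 => i _; exact: sqr_ge0. Qed.

Lemma dotv_eq0 a : (dotv a a == 0) = (a == 0).
Proof.
apply/eqP/eqP => [|->]; last by apply: big1 => i _; rewrite mxE mul0r.
move=> /eqP; rewrite psumr_eq0; last by move=> i _; exact: sqr_ge0.
move=> /allP h; apply/rowP => i; rewrite mxE.
by have := h i (mem_index_enum _); rewrite -expr2 sqrf_eq0 => /eqP.
Qed.

Lemma norm2_eq1 a : norm2 a = 1 <-> dotv a a = 1.
Proof.
rewrite /norm2; split => [h|->]; last by rewrite sqrtr1.
by rewrite -[LHS]sqr_sqrtr ?dotv_ge0// h expr1n.
Qed.

(** A crude estimate in the sup norm, used to find a ball inside the polar of a bounded set. *)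
Lemma dotv_bound a b : `|dotv a b| <= n%:R * (`|a| * `|b|).
Proof.
apply: le_trans (ler_norm_sum _ _ _) _.
rewrite -[n in n%:R]card_ord mulr_natl -sumr_const; apply: ler_sum => k _.
by rewrite normrM ler_pM// normr_mxE_le.
Qed.

Lemma polarP K a : polar K a <-> forall b, K b -> `|dotv a b| <= 1.
Proof.
rewrite /polar /=; split => [h b Kb|h].
  by rewrite -lee_fin; apply: le_trans h; apply: ereal_sup_ubound; exists b.
by apply: ge_ereal_sup => _ [b Kb <-]; rewrite lee_fin h.
Qed.

Lemma absorbing_disk_polar W : compact W -> absorbing_disk (polar W).
Proof.
move=> /compact_bounded [M [_ WM]]; split.
- move=> x y t /andP[t0 t1] /polarP hx /polarP hy; apply/polarP => b Wb.
  rewrite dotvDl !dotvZl; apply: le_trans (ler_normD _ _) _.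
  have t10 : 0 <= 1 - t by rewrite subr_ge0.
  rewrite !normrM (ger0_norm t0) (ger0_norm t10).
  have := ler_wpM2l t0 (hx b Wb); have := ler_wpM2l t10 (hy b Wb); lra.
- by move=> x /polarP hx; apply/polarP => b Wb; rewrite dotvNl normrN hx.
(* Here [n.+1] and [|M| + 1] replace [n] and [M] so that the inverse is a positive radius even when
   [n = 0]. *)
- have N0 : 0 < n.+1%:R * (`|M| + 1) by rewrite mulr_gt0// ltr_wpDl.
  exists (n.+1%:R * (`|M| + 1))^-1; first by rewrite invr_gt0.
  move=> x xr; apply/polarP => b Wb.
  apply: le_trans (dotv_bound _ _) _.
  have bM : `|b| <= `|M| + 1.
    by apply: WM => //; rewrite (le_lt_trans (ler_norm _))// ltrDl.
  rewrite mulrCA; apply: (@le_trans _ _ (`|x| * (n.+1%:R * (`|M| + 1)))).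
    by rewrite ler_wpM2l// ler_pM// ler_nat.
  by rewrite -ler_pdivlMr// mul1r.
Qed.

(** If [a = t *: b = s *: c] with [b] in [W] and [c] in its polar, then
    [dotv a a = t * s * dotv c b <= t * s]. The infimum is taken over [s] first, then over [t]. *)
Lemma dotv_le_body_norm_polar W a : absorbing_disk W -> compact W ->
  dotv a a <= body_norm W a * body_norm (polar W) a.
Proof.
move=> dW cW; have dP := absorbing_disk_polar cW.
have h t : 0 < t -> forall b, W b -> a = t *: b ->
    dotv a a / t <= body_norm (polar W) a.
  move=> t0 b Wb aE; apply: body_norm_ge => // s c s0 /polarP Pc aE'.
  rewrite ler_pdivrMr// {2}aE {1}aE' dotvZl dotvZr ler_pM2l// -[leRHS]mulr1.
  by rewrite ler_pM2l//; exact: le_trans (ler_norm _) (Pc b Wb).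
(* The second infimum requires division by the polar gauge, so its vanishing is treated apart: a
   single [t] then gives [dotv a a <= 0]. *)
have := body_norm_ge0 a dP; rewrite le_eqVlt => /predU1P[e0|p0].
  have [t [b [t0 Wb aE _]]] := body_norm_adherent a dW ltr01.
  have := h t t0 b Wb aE; rewrite -e0 mulr0 pmulr_lle0//.
  by rewrite invr_gt0.
rewrite -ler_pdivrMr//; apply: body_norm_ge => // t b t0 Wb aE.
by rewrite ler_pdivrMr// mulrC -ler_pdivrMr//; exact: h aE.
Qed.

Lemma norm2_le_body_norm V a : absorbing_disk V -> V `<=` @unit_ball2 R n ->
  norm2 a <= body_norm V a.
Proof.
move=> dV VB; apply: body_norm_ge => // t b t0 /VB bB ->.
rewrite /norm2 dotvZl dotvZr mulrA -expr2 sqrtrM ?sqr_ge0//.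
by rewrite sqrtr_sqr gtr0_norm// -[leRHS]mulr1 ler_pM2l.
Qed.

End dot.

(** * Orthogonal projections *)

Lemma row_free_gram {R : realType} {m n} (B : 'M[R]_(m, n)) :
  row_free B -> B *m B^T \in unitmx.
Proof.
move=> freeB; rewrite -row_free_unit -kermx_eq0; apply/rowV0P => v.
move/sub_kermxP; rewrite mulmxA => vBB.
(* A kernel vector [v] of the Gram matrix makes the squared length of [v *m B] vanish. *)
apply/eqP; rewrite -(mulmx_free_eq0 _ freeB) -dotv_eq0 dotvE trmx_mul.
by rewrite mulmxA vBB mul0mx mxE.
Qed.

(** With a basis of [L] as the rows of [B], the projection is $B^T (B B^T)^{-1} B$. Cyclicity turns
    its trace into that of the identity of size [\dim L]. *)
Lemma orthogonal_projection {R : realType} {n} (L : {vspace 'rV[R]_n}) :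
  exists P : 'M[R]_n, [/\ P^T = P, P *m P = P, \tr P = (\dim L)%:R &
    forall x, x *m P \in L].
Proof.
pose B : 'M[R]_(\dim L, n) := \matrix_i (vbasis L)`_i.
have freeB : row_free B.
  apply: inj_row_free => v; rewrite mulmx_sum_row => vB.
  apply/rowP => i; rewrite mxE.
  apply: (freeP (basis_free (vbasisP L)) (v ord0)); rewrite -[RHS]vB.
  by apply: eq_bigr => j _; rewrite rowK.
exists (B^T *m invmx (B *m B^T) *m B).
have uB := row_free_gram freeB.
split.
- by rewrite !trmx_mul trmxK trmx_inv trmx_mul trmxK mulmxA.
- by rewrite !mulmxA -(mulmxA _ B) -(mulmxA _ (B *m _)) mulmxV// mulmx1.
- by rewrite mxtrace_mulC mulmxA mulmxV// mxtrace1.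
- move=> x; rewrite mulmxA mulmx_sum_row; apply: memv_suml => i _.
  by rewrite rowK memvZ// vbasis_mem// mem_nth// size_tuple.
Qed.

(** * Topology, measurability and rotation invariance on the sphere *)

Section sphere.
Context {R : realType} {n : nat}.
Implicit Types (f : 'rV[R]_n -> R) (Q : 'M[R]_n).

Let coord_cont (k : 'I_n) : continuous (fun x : 'rV[R]_n => x ord0 k).
Proof. exact: coord_continuous. Qed.

Lemma continuous_sum (I : Type) (s : seq I) (P : pred I)
    (F : I -> 'rV[R]_n -> R) :
  (forall i, continuous (F i)) ->
  continuous (fun x => \sum_(i <- s | P i) F i x).
Proof.
move=> cF; elim: s => [|i s IH].
  rewrite (_ : (fun _ => _) = cst 0); first exact: cst_continuous.
  by apply/funext => x; rewrite big_nil.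
case Pi : (P i).
  rewrite (_ : (fun _ => _) = F i \+ (fun x => \sum_(i <- s | P i) F i x)).
    by move=> x; apply: continuousD; [exact: cF|exact: IH].
  by apply/funext => x; rewrite big_cons Pi.
rewrite (_ : (fun _ => _) = fun x => \sum_(i <- s | P i) F i x)//.
by apply/funext => x; rewrite big_cons Pi.
Qed.

Lemma continuous_mulmxr_coord Q k :
  continuous (fun x : 'rV[R]_n => (x *m Q) ord0 k).
Proof.
rewrite (_ : (fun _ => _) = fun x : 'rV[R]_n => \sum_j x ord0 j * Q j k).
  apply: continuous_sum => j x; apply: continuousM; first exact: coord_cont.
  exact: cst_continuous.
by apply/funext => x; rewrite mxE.
Qed.

Lemma continuous_dotv Q : continuous (fun x : 'rV[R]_n => dotv (x *m Q) x).
Proof.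
apply: continuous_sum => i x; apply: continuousM; last exact: coord_cont.
exact: continuous_mulmxr_coord.
Qed.

Lemma compact_unit_sphere2 : compact (@unit_sphere2 R n).
Proof.
apply: bounded_closed_compact.
  exists 1; split => // M M1 x /norm2_eq1 x1 /=.
  rewrite {1}/Num.Def.normr/= mx_normrE; apply: bigmax_le => [|[i j] _ /=].
    by rewrite (le_trans _ (ltW M1)).
  apply: le_trans (ltW M1); rewrite ord1.
  rewrite -[leRHS]normr1 -ler_sqr ?nnegrE// !real_normK ?num_real// expr1n -x1.
  rewrite expr2 /dotv (bigD1 j)//= lerDl.
  by apply: sumr_ge0 => k _; exact: sqr_ge0.
rewrite (_ : @unit_sphere2 R n = (fun x => dotv (x *m 1%:M) x) @^-1` [set 1]).
  apply: preimage_closed; last exact: closed_eq.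
  by move=> x _; exact: continuous_dotv.
by apply/funext => x /=; apply/propext; rewrite mulmx1; exact: norm2_eq1.
Qed.

Lemma open_measurable_rV (U : set (borel_rV R n)) :
  @open 'rV[R]_n U -> measurable U.
Proof. by move=> oU; apply: sub_sigma_algebra. Qed.

Lemma measurable_unit_sphere2 :
  @measurable _ (borel_rV R n) (@unit_sphere2 R n).
Proof.
rewrite -[X in measurable X]setCK; apply: measurableC.
apply: open_measurable_rV; apply: closed_openC.
by apply: compact_closed compact_unit_sphere2.
Qed.

Lemma measurable_continuous_rV f : continuous f ->
  @measurable_fun _ _ (borel_rV R n) R setT f.
Proof.
move=> /continuousP cf.
apply: (measurability _ (measurable_realfun.RGenOpens.measurableE R)).
move=> _ [_ [a [b ->] <-]]; rewrite setTI; apply: open_measurable_rV.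
exact/cf/interval_open.
Qed.

Lemma continuous_mulmxr Q : continuous (fun x : 'rV[R]_n => x *m Q).
Proof.
move=> x; apply/(@cvgrPdist_le _ _ _ _ (nbhs_filter x)) => e e0; near=> y.
rewrite {1}/Num.Def.normr/= mx_normrE; apply: bigmax_le => [|[i j] _ /=].
  exact: ltW.
rewrite ord1 -mulmxBl mxE; apply: le_trans (ler_norm_sum _ _ _) _.
apply: (@le_trans _ _ (n.+1%:R * (`|x - y| * (`|Q| + 1)))).
  apply: (@le_trans _ _ (\sum_(k < n) `|x - y| * (`|Q| + 1))); last first.
    by rewrite sumr_const card_ord -[leLHS]mulr_natl ler_wpM2r ?ler_nat//.
  apply: ler_sum => k _; rewrite normrM ler_pM ?normr_mxE_le//.
  by rewrite ler_wpDr// normr_mxE_le.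
have C0 : 0 < n.+1%:R * (`|Q| + 1) by rewrite mulr_gt0// ltr_wpDl.
rewrite mulrCA -ler_pdivlMr//; near: y.
have /cvgrPdist_le : id @ x --> x by exact: cvg_id.
by apply; rewrite divr_gt0.
Unshelve. all: by end_near. Qed.

Lemma measurable_mulmxr Q :
  @measurable_fun _ _ (borel_rV R n) (borel_rV R n) setT
    (fun x : 'rV[R]_n => x *m Q).
Proof.
apply: (@measurability _ _ (borel_rV R n) (borel_rV R n) _ _ (@open 'rV[R]_n)).
  by [].
move=> _ [U oU <-]; rewrite setTI; apply: open_measurable_rV.
by have /continuousP := @continuous_mulmxr Q; exact.
Qed.

Context (mu : probability (borel_rV R n) R).

(** A continuous function is bounded on the compact sphere, which has finite measure. *)
Lemma integrable_continuous_sphere f : continuous f ->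
  mu.-integrable (@unit_sphere2 R n) (EFin \o f).
Proof.
move=> cf; apply: measurable_bounded_integrable.
- exact: measurable_unit_sphere2.
- apply: (le_lt_trans (probability_le1 mu _)); rewrite ?ltry//.
  exact: measurable_unit_sphere2.
- apply: measurable_funTS; exact: measurable_continuous_rV.
have /compact_bounded[M [_ mrt]] : compact (f @` @unit_sphere2 R n).
  apply: continuous_compact compact_unit_sphere2.
  exact: continuous_subspaceT.
exists M; split; rewrite ?num_real // => r Mr x Sx.
by apply: (mrt _ Mr); exists x.
Qed.

Lemma unit_sphere2_mulmxr Q (x : 'rV[R]_n) : Q *m Q^T = 1%:M ->
  @unit_sphere2 R n (x *m Q) <-> @unit_sphere2 R n x.
Proof.
move=> QQ; rewrite /unit_sphere2/= /norm2.
by rewrite !dotvE trmx_mul mulmxA -(mulmxA x) QQ mulmx1.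
Qed.

(** Change of variables: the image of [mu] under the rotation agrees with [mu] on measurable sets,
    and the sphere is its own preimage. *)
Lemma Rintegral_sphere_rotation Q f : uniform_on_sphere mu ->
  Q *m Q^T = 1%:M -> continuous f ->
  \int[mu]_(x in @unit_sphere2 R n) f (x *m Q) =
  \int[mu]_(x in @unit_sphere2 R n) f x.
Proof.
move=> [_ inv] QQ cf; rewrite /Rintegral; congr fine.
pose phi : borel_rV R n -> borel_rV R n := fun x : 'rV[R]_n => x *m Q.
have SQ : phi @^-1` (@unit_sphere2 R n) = @unit_sphere2 R n.
  by apply/funext => x; apply/propext; exact: unit_sphere2_mulmxr.
have mphi : measurable_fun setT phi by exact: measurable_mulmxr.
transitivity (\int[pushforward mu phi]_(x in @unit_sphere2 R n) (f x)%:E)%E.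
  rewrite integral_pushforward//=.
  - by rewrite SQ.
  - apply/measurable_realfun.measurable_EFinP.
    exact: measurable_continuous_rV.
  - rewrite SQ; apply: (@integrable_continuous_sphere (f \o (fun x => x *m Q))).
    by move=> x; apply: continuous_comp; [exact: continuous_mulmxr|exact: cf].
  - exact: measurable_unit_sphere2.
apply: eq_measure_integral => A mA _; exact: inv.
Qed.

End sphere.

(** * Second moments of the uniform measure *)

Section moments.
Context {R : realType} {n : nat} (mu : probability (borel_rV R n) R).
Hypothesis umu : uniform_on_sphere mu.
Implicit Types f g : 'rV[R]_n -> R.

Local Notation S := (@unit_sphere2 R n).
Local Notation E f := (\int[mu]_(x in S) f x).

Let mS := @measurable_unit_sphere2 R n.

Lemma continuous_cmul c f : continuous f -> continuous (fun x => c * f x).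
Proof.
move=> cf x; apply: (@continuousM _ _ (cst c) f x); last exact: cf.
exact: cst_continuous.
Qed.

Lemma continuous_add f g : continuous f -> continuous g ->
  continuous (fun x => f x + g x).
Proof. by move=> cf cg x; apply: continuousD; [exact: cf|exact: cg]. Qed.

Lemma mean_cst c : E (fun=> c) = c.
Proof.
rewrite Rintegral_cst// (_ : fine _ = 1) ?mulr1//.
by have [/(congr1 fine)] := umu.
Qed.

Lemma mean_le f g : continuous f -> continuous g ->
  (forall x, S x -> f x <= g x) -> E f <= E g.
Proof.
move=> cf cg fg; apply: le_Rintegral => //;
  exact: integrable_continuous_sphere.
Qed.

Lemma meanD f g : continuous f -> continuous g ->
  E (fun x => f x + g x) = E f + E g.
Proof.
by move=> cf cg; rewrite RintegralD//; exact: integrable_continuous_sphere.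
Qed.

Lemma meanZ c f : continuous f -> E (fun x => c * f x) = c * E f.
Proof.
by move=> cf; rewrite RintegralZl//; exact: integrable_continuous_sphere.
Qed.

Lemma mean_sum (I : Type) (s : seq I) (F : I -> 'rV[R]_n -> R) :
  (forall i, continuous (F i)) ->
  E (fun x => \sum_(i <- s) F i x) = \sum_(i <- s) E (F i).
Proof.
move=> cF; elim: s => [|i s IH].
  by under eq_Rintegral do rewrite big_nil; rewrite mean_cst big_nil.
under eq_Rintegral do rewrite big_cons.
by rewrite meanD// ?IH ?big_cons//; exact: continuous_sum.
Qed.

Let mom j k := E (fun x : 'rV[R]_n => x ord0 j * x ord0 k).

Let cmom j k : continuous (fun x : 'rV[R]_n => x ord0 j * x ord0 k).
Proof. by move=> x; apply: continuousM; exact: coord_continuous. Qed.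

(** Changing the sign of the coordinate [j] is orthogonal and negates the integrand. *)
Lemma second_moment_neq j k : j != k -> mom j k = 0.
Proof.
move=> jk; pose Q : 'M[R]_n := diag_mx (\row_i (-1) ^+ (i == j)).
have QQ : Q *m Q^T = 1%:M.
  rewrite tr_diag_mx mulmx_diag; apply/matrixP => a b; rewrite !mxE.
  by rewrite -expr2 sqrr_sign.
have := Rintegral_sphere_rotation umu QQ (@cmom j k).
under eq_Rintegral do
  rewrite !mul_mx_diag !mxE eqxx (eq_sym k) (negbTE jk) mulr1 mulrN1 mulNr
    -mulN1r.
rewrite meanZ// => /eqP.
by rewrite mulN1r eq_sym -addr_eq0 -mulr2n mulrn_eq0/= => /eqP.
Qed.

(** Swapping two coordinates is orthogonal. *)
Lemma second_moment_eq j k : mom j j = mom k k.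
Proof.
have QQ : tperm_mx j k *m (tperm_mx j k)^T = 1%:M :> 'M[R]_n.
  by rewrite tr_tperm_mx -perm_mxM tperm2 perm_mx1.
rewrite [RHS]/mom -(Rintegral_sphere_rotation umu QQ (@cmom k k)).
apply: eq_Rintegral => x _.
by rewrite /tperm_mx -[tperm j k]invgK -col_permE mxE tpermV tpermR.
Qed.

(** The moment matrix is scalar, so the mean is [\tr A] times a common diagonal moment. The identity
    matrix, whose form is 1 on the sphere, shows that this moment is [1 / n]. *)
Lemma mean_quadratic_form (A : 'M[R]_n) :
  E (fun x => dotv (x *m A) x) * n%:R = \tr A.
Proof.
have quadE (B : 'M[R]_n) j : E (fun x => dotv (x *m B) x) = \tr B * mom j j.
  transitivity (E (fun x : 'rV[R]_n =>
      \sum_k \sum_i B i k * (x ord0 i * x ord0 k))).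
    apply: eq_Rintegral => x _; apply: eq_bigr => k _.
    by rewrite mxE mulr_suml; apply: eq_bigr => i _; rewrite mulrAC mulrC.
  have cB i k : continuous (fun x : 'rV[R]_n => B i k * (x ord0 i * x ord0 k)).
    exact/continuous_cmul/cmom.
  rewrite mean_sum; last by move=> k; apply: continuous_sum => i; exact: cB.
  rewrite /mxtrace mulr_suml; apply: eq_bigr => k _.
  rewrite mean_sum; last by move=> i; exact: cB.
  rewrite (bigD1 k)//= big1 ?addr0; last first.
    by move=> i ik; rewrite meanZ// -/(mom i k) second_moment_neq// mulr0.
  by rewrite meanZ// -/(mom k k) (second_moment_eq k j).
(* In dimension 0 no coordinate [j] exists, but both sides vanish. *)
have [n0|n0] := posnP n.
  rewrite [X in _ * X%:R]n0 mulr0 /mxtrace big1// => i.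
  by exfalso; move: (ltn_ord i); rewrite {2}n0.
pose j := Ordinal n0.
have : E (fun x : 'rV[R]_n => dotv (x *m 1%:M) x) = 1.
  rewrite -[RHS]mean_cst; apply: eq_Rintegral => x /set_mem /norm2_eq1.
  by rewrite mulmx1.
by rewrite !(quadE _ j) mxtrace1 => n1; rewrite -mulrA [_ * n%:R]mulrC n1 mulr1.
Qed.

End moments.

(** * Choice of the vector and the final estimate *)

Theorem theorem1 (R : realType) (eps : R) (heps : 0 < eps) :
  exists mu_eps C_eps : R,
    [/\ 0 < mu_eps, mu_eps < 1, 0 < C_eps &
      forall (n : nat) (mu : probability (borel_rV R n) R)
        (V W : set 'rV[R]_n) (L : {vspace 'rV[R]_n}),
        (0 < n)%N ->
        uniform_on_sphere mu ->
        symmetric_convex_body V ->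
        symmetric_convex_body W ->
        V `<=` @unit_ball2 R n ->
        mu_eps * n%:R <= (\dim L)%:R ->
        exists a : 'rV[R]_n,
          [/\ a \in L, a != 0 &
            body_norm V a / body_norm W a <=
              C_eps * levy_mean mu V `^ (1 + eps) * levy_mean mu (polar W)]].
Proof.
(* The value 64 is [8 * 8]: the selection inequality below costs a factor 8 for each of the two
   gauges. *)
exists (1 / 2), 64; split; [lra|lra|lra|].
move=> n mu V W L n0 umu bV bW VB dimL.
have dV := absorbing_disk_body bV; have dW := absorbing_disk_body bW.
have cW : compact W by case: bW.
have dP := absorbing_disk_polar cW.
have cV := body_norm_continuous dV; have cP := body_norm_continuous dP.
have MV1 : 1 <= levy_mean mu V.
  rewrite -[leLHS](mean_cst umu); apply: mean_le => //.
    exact: cst_continuous.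
  by move=> x <-; exact: norm2_le_body_norm.
(* On the sphere the product of the two gauges is at least 1, and the gauge of [W] is bounded there
   by compactness, so the polar gauge is bounded below. *)
have MP0 : 0 < levy_mean mu (polar W).
  have /compact_bounded[M [_ hM]] : compact (body_norm W @` @unit_sphere2 R n).
    apply: continuous_compact (@compact_unit_sphere2 R n).
    by apply: continuous_subspaceT; exact: body_norm_continuous.
  have M0 : 0 < `|M| + 1 by rewrite ltr_wpDl.
  apply: (@lt_le_trans _ _ (`|M| + 1)^-1); first by rewrite invr_gt0.
  rewrite -[leLHS](mean_cst umu); apply: mean_le => //.
    exact: cst_continuous.
  move=> x Sx; rewrite -[leLHS]mulr1 ler_pdivrMl//.
  have := dotv_le_body_norm_polar x dW cW.
  move/norm2_eq1 : (Sx) => ->; move/le_trans; apply.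
  rewrite ler_wpM2r ?body_norm_ge0//; apply: le_trans (ler_norm _) _.
  have hMM : M < `|M| + 1 by rewrite (le_lt_trans (ler_norm _))// ltrDl.
  by apply: (hM _ hMM (body_norm W x)); exists x.
have [P [trP PP trcP PL]] := orthogonal_projection L.
have dotP x : dotv (x *m P) (x *m P) = dotv (x *m P) x.
  by rewrite !dotvE trmx_mul trP !mulmxA -(mulmxA x) PP -mulmxA.
set MV := levy_mean mu V in MV1 *; set MP := levy_mean mu (polar W) in MP0 *.
have MV0 : 0 < MV by rewrite (lt_le_trans ltr01).
(* Each summand is normalized to mean 1, so that one choice of [x] controls both gauges. *)
pose F (x : 'rV[R]_n) := MV^-1 * body_norm V x + MP^-1 * body_norm (polar W) x.
have cF : continuous F.
  by apply: continuous_add; exact: continuous_cmul.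
have EF : \int[mu]_(x in @unit_sphere2 R n) F x = 2.
  rewrite meanD; [|exact: continuous_cmul..].
  rewrite !meanZ// -/(levy_mean mu V) -/(levy_mean mu (polar W)).
  by rewrite !mulVf ?gt_eqF//; lra.
pose Q : 'M[R]_n := 2 *: P - 1%:M.
have QQ : Q *m Q^T = 1%:M.
  rewrite /Q linearB/= linearZ/= trP trmx1 mulmxBl !mulmxBr !mul1mx !mulmx1.
  rewrite -!(scalemxAl, scalemxAr) PP.
  by apply/matrixP => i j; rewrite !mxE; lra.
have [x [Sx xP0 Fx]] : exists x, [/\ @unit_sphere2 R n x, x *m P != 0 &
    F (x *m P) <= 8 * dotv (x *m P) (x *m P)].
  apply: contrapT => noX.
  have hx x : @unit_sphere2 R n x ->
      8 * dotv (x *m P) x <= 2^-1 * (F x + F (x *m Q)).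
    move=> Sx; rewrite -dotP; apply: (@le_trans _ _ (F (x *m P))).
      (* Points with [x *m P = 0] satisfy the bound trivially, so it holds on the whole sphere and
         can be integrated. *)
      have [->|xP0] := eqVneq (x *m P) 0.
        rewrite (eqP (_ : dotv 0 0 == 0)) ?dotv_eq0// mulr0.
        by rewrite addr_ge0// mulr_ge0 ?body_norm_ge0// invr_ge0 ltW.
      rewrite leNgt; apply/negP => /ltW ?; apply: noX; by exists x.
    have -> : x *m P = 2^-1 *: (x + x *m Q).
      rewrite mulmxBr mulmx1 addrC subrK -scalemxAr scalerA mulVf ?scale1r//.
    have hV := body_norm_midpoint x (x *m Q) dV.
    have hP := body_norm_midpoint x (x *m Q) dP.
    rewrite -(ler_pM2l (_ : 0 < MV^-1)) ?invr_gt0// in hV.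
    rewrite -(ler_pM2l (_ : 0 < MP^-1)) ?invr_gt0// in hP.
    rewrite /F; lra.
  have cQ : continuous (fun x : 'rV[R]_n => F (x *m Q)).
    move=> y; apply: (@continuous_comp _ _ _ (fun x : 'rV[R]_n => x *m Q) F y).
      exact: continuous_mulmxr.
    exact: cF.
  have := @mean_le _ _ mu (fun x : 'rV[R]_n => 8 * dotv (x *m P) x)
    (fun x : 'rV[R]_n => 2^-1 * (F x + F (x *m Q))).
  rewrite !meanZ//; last 2 first.
  - exact: continuous_add.
  - exact: continuous_dotv.
  rewrite meanD// (Rintegral_sphere_rotation umu QQ cF) EF.
  have := mean_quadratic_form umu P; rewrite trcP => trE.
  have n0' : 0 < n%:R :> R by rewrite ltr0n.
  move: dimL; rewrite -trE ler_pM2r// => EP h.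
  (* The left side is at least [8 * (1 / 2) = 4], whereas the right side equals 2: a
     contradiction. *)
  suff : 8 * \int[mu]_(x in @unit_sphere2 R n) dotv (x *m P) x <=
    2^-1 * (2 + 2) by lra.
  apply: h hx.
  - exact/continuous_cmul/continuous_dotv.
  - exact/continuous_cmul/continuous_add.
exists (x *m P); split => //.
set a := x *m P in xP0 Fx *.
have d0 : 0 < dotv a a by rewrite lt_neqAle dotv_ge0 eq_sym dotv_eq0 xP0.
(* Since [dotv a x = dotv a a], the squared length of [x - a] is [1 - dotv a a]. *)
have d1 : dotv a a <= 1.
  have := dotv_ge0 (x - a); rewrite dotvDl dotvNl 2!(dotvC _ (x - a)) !dotvDl.
  rewrite !dotvNl (dotvC x a) -/(dotv a x) dotP.
  move/norm2_eq1 : Sx => ->; rewrite -dotP; lra.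
have aV : body_norm V a <= 8 * MV.
  have : MV^-1 * body_norm V a <= 8.
    have : 0 <= MP^-1 * body_norm (polar W) a.
      by rewrite mulr_ge0 ?body_norm_ge0// invr_ge0 ltW.
    move: Fx; rewrite /F; lra.
  by rewrite mulrC ler_pdivrMr.
(* The factor [dotv a a] is kept here, in contrast to the bound for [V], because it cancels in the
   duality inequality that follows. *)
have aP : body_norm (polar W) a <= 8 * dotv a a * MP.
  have : MP^-1 * body_norm (polar W) a <= 8 * dotv a a.
    have : 0 <= MV^-1 * body_norm V a.
      by rewrite mulr_ge0 ?body_norm_ge0// invr_ge0 ltW.
    move: Fx; rewrite /F; lra.
  by rewrite mulrC ler_pdivrMr.
have aW : 1 <= body_norm W a * (8 * MP).
  rewrite -(ler_pM2r d0) mul1r.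
  apply: le_trans (dotv_le_body_norm_polar a dW cW) _.
  by rewrite -mulrA ler_wpM2l ?body_norm_ge0// mulrAC.
(* Positivity makes the quotient genuine, as division by zero would return 0. *)
have W0 : 0 < body_norm W a.
  rewrite lt_neqAle body_norm_ge0// andbT; apply/eqP => e.
  by move: aW; rewrite -e mul0r; lra.
rewrite ler_pdivrMr//; apply: le_trans aV _.
have MVe : MV <= MV `^ (1 + eps).
  by rewrite -[leLHS](powRr1 (ltW MV0)) ler_powR// lerDl ltW.
apply: (@le_trans _ _ (8 * MV `^ (1 + eps))); first by rewrite ler_pM2l.
have -> : 64 * MV `^ (1 + eps) * MP * body_norm W a =
  8 * MV `^ (1 + eps) * (body_norm W a * (8 * MP)) by ring.
by rewrite -[leLHS]mulr1 ler_wpM2l// mulr_ge0// powR_ge0.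
Qed.
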